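(* Let $n\ge1$ and let $k$ be a positive divisor of $n$. Then the number of vertices of $\Gamma_n$ of the form $\langle k,l\rangle$ equals $\varphi(n/k)$, where $\varphi$ is Euler's totient function (with $\varphi(1)=1$).
   Context: $[n]=\{1,\dots,n\}$; for $x,y\in[n]$, $x\odot y$ is the element of $[n]$ congruent to $xy$ mod $n$. The directed graph $\Gamma_n=(V_n,\Psi)$ with $V_n\subseteq[n]\times[n]$ is built as follows: (1) for each $l$ with $1\le l<n$ and $\gcd(l,n)=1$, $\langle1,l\rangle\in V_n$; (2) whenever $\langle k,l\rangle\in V_n$ and $p$ is a prime divisor of $n$ with $kp\mid n$, then $\langle kp,l\odot p\rangle\in V_n$ and there is an arc from $\langle k,l\rangle$ to $\langle kp,l\odot p\rangle$; (3) repeat (2) until nothing new arises (so $V_n$ is the smallest set closed under these rules).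
   Formalization: Rule (1) is taken with 1 ≤ l ≤ n instead of 1 ≤ l < n; this is the same for n ≥ 2, but for n = 1 it adds the vertex ⟨1,1⟩, without which Γ_1 would be empty and the claim false at n = k = 1. *)

(* Defs.v *)
From mathcomp Require Import all_boot.
From mathcomp Require Import boolp classical_sets functions cardinality.

Set Implicit Arguments.
Unset Strict Implicit.
Unset Printing Implicit Defensive.

Local Open Scope classical_set_scope.

Record digraph (T : Type) := Digraph {
  vertices : set T;
  arcs : set (T * T) }.

(* The residue system is {1, ..., n}: the class of 0 is represented by n. *)
Definition odot (n x y : nat) : nat :=
  if n %| x * y then n else (x * y) %% n.

(* The source rule is stated in the literature with 1 <= l < n. The bound l <= n gives
   the same vertices when n >= 2, see source_rangeE, and it also gives the
   source (1, 1) when n = 1: with l < n the graph for n = 1 would be empty,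
   although totient 1 = 1. *)
Inductive Gamma_vertex (n : nat) : nat * nat -> Prop :=
| Gamma_source l : 1 <= l <= n -> coprime l n -> Gamma_vertex n (1, l)
| Gamma_step k l p : Gamma_vertex n (k, l) -> prime p -> p %| n ->
    k * p %| n -> Gamma_vertex n (k * p, odot n l p).

Inductive Gamma_arc (n : nat) : (nat * nat) * (nat * nat) -> Prop :=
| Gamma_step_arc k l p : Gamma_vertex n (k, l) -> prime p -> p %| n ->
    k * p %| n -> Gamma_arc n ((k, l), (k * p, odot n l p)).

Definition Gamma (n : nat) : digraph (nat * nat) :=
  Digraph [set v | Gamma_vertex n v] [set a | Gamma_arc n a].

Lemma source_rangeE n l : 1 < n ->
  (1 <= l <= n) && coprime l n = (1 <= l < n) && coprime l n.
Proof.
move=> n1; rewrite [l <= n]leq_eqVlt.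
case: eqP => //= ->; rewrite ltnn !andbF /=.
by rewrite /coprime gcdnn (gtn_eqF n1) andbF.
Qed.

Lemma odot_range n x y : 0 < n -> 1 <= odot n x y <= n.
Proof.
move=> n0; rewrite /odot; case: ifPn => [_|nd]; first by rewrite n0 leqnn.
by rewrite lt0n [_ == _](negbTE nd) ltnW // ltn_mod.
Qed.

Lemma odot_mod n x y : odot n x y = x * y %[mod n].
Proof.
rewrite /odot; case: ifP => [/eqP ->|_]; first exact: modnn.
exact: modn_mod.
Qed.

Lemma Gamma_vertex_range n v : 0 < n -> Gamma_vertex n v ->
  (1 <= v.1 <= n) && (1 <= v.2 <= n).
Proof.
move=> n0; case=> [l ln _|k l p _ _ _ kn] /=; first by rewrite n0 ln.
by rewrite odot_range // andbT (dvdn_gt0 n0 kn) dvdn_leq.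
Qed.

(* Main.v *)
Require Import Defs.
From mathcomp Require Import all_boot.
From mathcomp Require Import boolp classical_sets functions cardinality.
From mathcomp Require Import zify.

(** The second coordinate determines the first: for [1 <= l <= n], the pair
[(k, l)] is a vertex of [Gamma n] iff [gcdn l n = k]. The gcd is preserved by
the construction because the step at [p] is only allowed when [k * p %| n].
Conversely a vertex at level [k * p] is reached from one of the two
candidates [l %/ p] and [l %/ p + n %/ p], at least one of which has gcd [k]
with [n]. The numbers of [1, ..., n] whose gcd with [n] is [k] are the
[k * j] with [j] in [1, ..., n %/ k] coprime to [n %/ k]. *)

Local Open Scope classical_set_scope.
Local Open Scope card_scope.

Lemma card_uniq_seq (T : eqType) (s : seq T) :
  uniq s -> [set` s] #= `I_(size s).
Proof.
(* The nonempty case supplies [x0] as the default value of [nth]. *)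
case: s => [|x0 s'] us.
  by rewrite (_ : [set` [::]] = set0) ?II0 ?card_eq00 //; apply/seteqP; split.
move: (x0 :: s') us => s us.
have -> : [set` s] = nth x0 s @` `I_(size s).
  apply/seteqP; split=> [x /= xs|_ [i /= ilt <-]]; last exact: mem_nth.
  by exists (index x s); rewrite /= ?index_mem ?nth_index.
apply: inj_card_eq => i j; rewrite !inE /= => ilt jlt.
by move/eqP; rewrite nth_uniq // => /eqP.
Qed.

(** The difference is a multiple of [n] smaller than [n], hence zero. This turns congruences back
    into equalities of representatives. *)
Lemma eq_mod_range n x y :
  1 <= x <= n -> 1 <= y <= n -> x = y %[mod n] -> x = y.
Proof.
wlog le_xy : x y / x <= y => [W Hx Hy e|Hx Hy /esym/eqP].
  by have [le_xy|/ltnW le_yx] := leqP x y; [exact: W | symmetry; exact: W].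
rewrite eqn_mod_dvd // => dv.
move: le_xy; rewrite leq_eqVlt => /orP[/eqP //|lt_xy].
have := @dvdn_leq n (y - x); rewrite dv subn_gt0 lt_xy => /(_ isT isT); lia.
Qed.

Lemma gcdn_odot n x y : gcdn (odot n x y) n = gcdn (x * y) n.
Proof. by rewrite -gcdn_modl odot_mod gcdn_modl. Qed.

(** Dividing by [k] leaves coprime cofactors [a] of [l] and [b] of [n], and [k * p %| n] becomes
    [p %| b]; hence [gcdn (a * p) b = gcdn p b = p]. *)
Lemma gcdn_mulr_dvd n k l p : 0 < n ->
  gcdn l n = k -> k * p %| n -> gcdn (l * p) n = k * p.
Proof.
move=> n0 gk kpn.
have k0 : 0 < k by rewrite -gk gcdn_gt0 n0 orbT.
have /dvdnP[a la] : k %| l by rewrite -gk dvdn_gcdl.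
have /dvdnP[b nb] : k %| n by rewrite -gk dvdn_gcdr.
have cba : coprime b a.
  by move/eqP: gk; rewrite la nb -muln_gcdl -{2}(mul1n k) eqn_pmul2r // gcdnC.
move: kpn; rewrite la nb mulnC dvdn_pmul2r // => pb.
by rewrite mulnAC -muln_gcdl gcdnC Gauss_gcdr // gcdnC (gcdn_idPl pb) mulnC.
Qed.

Lemma Gamma_vertex_gcd n v : 0 < n -> Gamma_vertex n v -> gcdn v.2 n = v.1.
Proof.
move=> n0; elim=> [l _ /eqP //|k l p _ gk _ _ kpn] /=.
by rewrite gcdn_odot (gcdn_mulr_dvd _ _ _ _ n0 gk).
Qed.

(** Adding a multiple of [b] keeps [a] coprime to [b], so only [p] matters. It cannot divide both
    [a] and [a + b], since it would then divide [gcdn a b], which is 1. *)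
Lemma coprime_prime_shift p a b : prime p -> coprime a b ->
  exists2 t, t <= 1 & coprime (a + t * b) (p * b).
Proof.
move=> pp cab; have [pa|pa] := boolP (p %| a); last first.
  exists 0 => //; rewrite mul0n addn0 coprimeMr cab andbT.
  by rewrite coprime_sym prime_coprime.
exists 1 => //; rewrite mul1n coprimeMr; apply/andP; split; last first.
  by rewrite coprime_sym /coprime gcdnDr -/(coprime b a) coprime_sym.
rewrite coprime_sym prime_coprime // dvdn_addr //.
apply/negP => pb; have : p %| gcdn a b by rewrite dvdn_gcd pa pb.
by rewrite (eqP cab) dvdn1; case: eqP pp => // ->.
Qed.

Lemma Gamma_vertex_of_gcd n l : 1 <= l <= n -> Gamma_vertex n (gcdn l n, l).
Proof.
move: {2}(gcdn l n) (erefl (gcdn l n)) => k gk.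
elim/ltn_ind: k l gk => k IH l gk lr; rewrite gk.
have n0 : 0 < n by lia.
have k0 : 0 < k by rewrite -gk gcdn_gt0 n0 orbT.
have [k1|k1] := leqP k 1.
  have -> : k = 1 by lia.
  by apply: Gamma_source => //; rewrite /coprime gk; lia.
have pp := pdiv_prime k1; move: (pdiv k) (pdiv_dvd k) pp => p /dvdnP[k' ek] pp.
have p1 := prime_gt1 pp.
have k'0 : 0 < k' by move: k0; rewrite ek muln_gt0 => /andP[].
have /dvdnP[a la] : k %| l by rewrite -gk dvdn_gcdl.
have /dvdnP[b nb] : k %| n by rewrite -gk dvdn_gcdr.
have cab : coprime a b.
  by move/eqP: gk; rewrite la nb -muln_gcdl -{2}(mul1n k) eqn_pmul2r.
have a0 : 0 < a by move: lr; rewrite la; case: (a).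
have b0 : 0 < b by move: n0; rewrite nb; case: (b).
have ab : a <= b by move: lr; rewrite la nb leq_pmul2r // => /andP[].
have [t t1 ct] := coprime_prime_shift p a b pp cab.
have en : n = k' * (p * b) by rewrite nb ek; lia.
(* As [k' * a] is [l %/ p] and [k' * b] is [n %/ p], this is the predecessor candidate selected by
   [t], with [m * p = l + t * n]. *)
pose m := k' * (a + t * b).
have gm : gcdn m n = k' by rewrite en -muln_gcdr (eqP ct) muln1.
have mr : 1 <= m <= n.
  rewrite /m muln_gt0 k'0 addn_gt0 a0 /= en leq_pmul2l //.
  (* Both [a] and [t * b] are at most [b], and [2 <= p]. *)
  by apply: (@leq_trans (2 * b)); [nia | rewrite leq_mul2r p1 orbT].
have kn : k' * p %| n by rewrite -ek nb dvdn_mull.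
have vm : Gamma_vertex n (k', m) by rewrite -{1}gm; apply: (IH k') => //; nia.
have -> : l = odot n m p.
  apply: (@eq_mod_range n) => //; first exact: odot_range.
  rewrite odot_mod (_ : m * p = t * n + l) ?modnMDl //.
  by rewrite la en ek /m; lia.
by rewrite {1}ek; apply: Gamma_step => //; apply: dvdn_trans kn; exact: dvdn_mull.
Qed.

Lemma Gamma_vertexE n k l : 0 < n ->
  Gamma_vertex n (k, l) <-> (1 <= l <= n) /\ gcdn l n = k.
Proof.
move=> n0; split=> [v|[lr <-]]; last exact: Gamma_vertex_of_gcd.
split; last exact: Gamma_vertex_gcd v.
by have /andP[] := Gamma_vertex_range n0 v.
Qed.

Lemma coprime_subr m i : i <= m -> coprime m (m - i) = coprime m i.
Proof.
move=> im; rewrite /coprime -{1}(subnK im) gcdnC gcdnDl.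
by rewrite -[X in _ = (gcdn X _ == 1)](subnK im) [in RHS]gcdnC gcdnDr gcdnC.
Qed.

Lemma totient_size_filter m :
  totient m = size [seq i <- iota 0 m | coprime m i].
Proof.
rewrite totient_count_coprime size_filter -sum1_count [RHS]big_mkcond.
by rewrite /index_iota subn0; apply: eq_bigr => i _; case: ifP.
Qed.

Theorem theorem3 (n k : nat) (hn : 1 <= n) (hk : 0 < k) (hkn : k %| n) :
  [set v | vertices (Gamma n) v /\ v.1 = k] #= `I_(totient (n %/ k)).
Proof.
move/dvdnP: hkn hn => [m ->] mk0; rewrite mulnK //.
have m0 : 0 < m by move: mk0; rewrite muln_gt0 => /andP[].
pose s := [seq i <- iota 0 m | coprime m i].
(* [totient] counts residues in [0, m), hence the reflection [i |-> m - i]. *)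
pose f i := (k, (m - i) * k).
have sP i : (i \in s) = coprime m i && (i < m).
  by rewrite mem_filter mem_iota add0n.
have -> : [set v | vertices (Gamma (m * k)) v /\ v.1 = k] = [set` map f s].
  apply/seteqP; split=> [[k' l] [/= + ek]|_ /= /mapP[i + ->]].
    rewrite {k'}ek => /(Gamma_vertexE _ _ _ mk0)[lr gk].
    have /dvdnP[j lj] : k %| l by rewrite -gk dvdn_gcdl.
    move: lr gk; rewrite lj muln_gt0 hk andbT leq_pmul2r // => /andP[j0 jm].
    move/eqP; rewrite -muln_gcdl -[X in _ == X]mul1n eqn_pmul2r // => cjm.
    (* Since [j] lies in [1, m], its reflection lies in [0, m); [j = m] goes to 0, which is coprime
       to [m] exactly when [m = 1]. *)
    apply/mapP; exists (m - j); last by rewrite /f subKn.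
    by rewrite sP ltn_subrL j0 m0 !andbT coprime_subr // coprime_sym.
  rewrite sP => /andP[cmi im]; split=> //=.
  apply/(Gamma_vertexE _ _ _ mk0); split; last first.
    rewrite -muln_gcdl (eqP (_ : coprime (m - i) m)) ?mul1n //.
    by rewrite coprime_sym coprime_subr // ltnW.
  by rewrite muln_gt0 subn_gt0 im hk leq_pmul2r // leq_subr.
rewrite totient_size_filter -/s -(size_map f s).
apply: card_uniq_seq; rewrite map_inj_in_uniq ?filter_uniq ?iota_uniq //.
(* Truncated subtraction from [m] is injective only up to [m], so the bounds on [i] and [j] are
   kept. *)
move=> i j; rewrite !sP => /andP[_ im] /andP[_ jm] [] /eqP.
by rewrite eqn_pmul2r // => /eqP; lia.
Qed.
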